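(* The extended bicyclic semigroup $\mathscr{C}_{\mathbb{Z}}$ is not finitely generated as a semigroup.
   Context: The extended bicyclic semigroup $\mathscr{C}_{\mathbb{Z}}$ is the set $\mathbb{Z}\times\mathbb{Z}$ with the associative operation $(a,b)\cdot(c,d)=(a-b+c,d)$ if $b<c$; $(a,d)$ if $b=c$; $(a,d+b-c)$ if $b>c$. *)

(* Defs.v *)
From HB Require Import structures.
From mathcomp Require Import all_boot all_order all_algebra.
From mathcomp Require Import zify.

Set Implicit Arguments.
Unset Strict Implicit.
Unset Printing Implicit Defensive.

Import Order.TTheory GRing.Theory Num.Theory.
Local Open Scope ring_scope.

(* An alias of int * int, so that the semigroup law below does not interfere
   with structures inferred on plain pairs. *)
Definition ext_bicyclic : Type := (int * int)%type.

HB.instance Definition _ := Choice.on ext_bicyclic.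

Definition ext_bicyclic_mul (x y : ext_bicyclic) : ext_bicyclic :=
  let: (a, b) := x in
  let: (c, d) := y in
  if b < c then (a - b + c, d)
  else if b == c then (a, d)
  else (a, d + b - c).

Lemma ext_bicyclic_mulA : associative ext_bicyclic_mul.
Proof.
move=> [a b] [c d] [e f]; rewrite /ext_bicyclic_mul.
by do ![case: ifP => ?]; congr (_, _); lia.
Qed.

HB.instance Definition _ :=
  isSemigroup.Build ext_bicyclic ext_bicyclic_mulA.

(* The subsemigroup generated by A, i.e. the nonempty finite products of
   elements of A. *)
Inductive semigroup_span (G : semigroupType) (A : G -> Prop) : G -> Prop :=
| semigroup_span_gen x : A x -> semigroup_span A x
| semigroup_span_mul x y : semigroup_span A x -> semigroup_span A y ->
    semigroup_span A (x * y)%g.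

Definition semigroup_finitely_generated (G : semigroupType) : Prop :=
  exists s : seq G, forall x : G, semigroup_span (fun y => y \in s) x.

(* Main.v *)
(** In a product [x * y] the first coordinate is at least that of [x]. Hence, for
    every [m], the elements with first coordinate at least [m] form a proper
    subsemigroup, and any finite set lies in one of these. *)

Require Import Defs.
From HB Require Import structures.
From mathcomp Require Import all_boot all_order all_algebra.
From mathcomp Require Import zify.

(** The first coordinate [a] changes only when [b < c], and then it grows by [c - b > 0]. *)
Lemma ext_bicyclic_mul_fst_ge (x y : ext_bicyclic) : (x.1 <= (x * y)%g.1)%R.
Proof.
case: x y => [a b] [c d]; change (a <= (ext_bicyclic_mul (a, b) (c, d)).1)%R.
by rewrite /ext_bicyclic_mul; do ![case: ifP => ?] => /=; lia.
Qed.

(** By induction on the span: a product inherits the lower bound from its left factor. *)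
Lemma semigroup_span_fst_ge (A : ext_bicyclic -> Prop) (m : int) :
  (forall x, A x -> (m <= x.1)%R) ->
  forall x, semigroup_span A x -> (m <= x.1)%R.
Proof.
move=> leA x; elim=> [|{}x y _ lex _ _]; first exact: leA.
exact: Order.POrderTheory.le_trans lex (ext_bicyclic_mul_fst_ge x y).
Qed.

Lemma seq_fst_lower_bound (s : seq ext_bicyclic) :
  exists m : int, forall x, x \in s -> (m <= x.1)%R.
Proof.
elim: s => [|y s [m lem]]; first by exists 0%R.
exists (Order.min y.1 m) => x; rewrite inE Order.TotalTheory.ge_min.
by case/predU1P=> [->|/lem ->]; rewrite ?Order.POrderTheory.lexx ?orbT.
Qed.

Theorem corollary1p6 : ~ semigroup_finitely_generated ext_bicyclic.
Proof.
case=> s gen_s; have [m lem] := seq_fst_lower_bound s.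
(* The first coordinate [m - 1] lies just below the bound [m] for the span of [s]; the second
   coordinate [0] is arbitrary. *)
have /= := @semigroup_span_fst_ge _ m lem _ (gen_s (m - 1, 0)%R).
by lia.
Qed.
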